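(* Let $(A,\mu,\alpha,\beta)$ be a unitary BiHom-associative algebra with unit $1$, where $\alpha,\beta$ are bijective, and let $\psi,\omega:A\to A$ be linear maps, each commuting with both $\alpha$ and $\beta$, satisfying $\psi(ab)=\psi(a)\psi(b)$, $\omega(ab)=\omega(a)\omega(b)$ for all $a,b\in A$, and $\psi(1)=\omega(1)=1$. Let $\delta_{1},\delta_{2}:A\to A\otimes A$ be two BiHom-derivations, and let $\Delta:A\to A\otimes A$ be a linear map with $(F\otimes F)\circ\Delta=\Delta\circ F$ for $F\in\{\alpha,\beta,\psi,\omega\}$. Then $\Delta$ is a coassociative covariant BiHom-derivation with respect to $(\delta_{1},\delta_{2})$ if and only if there exists an element $u=u^{1}\otimes u^{2}\in A\otimes A$ such that for all $a\in A$, $$(\delta_{1}-\delta_{2})(a)=\alpha^{-1}(a)\triangleright u-u\triangleleft\beta^{-1}(a),$$ $$(\delta_{1}\otimes\psi-\omega\otimes\delta_{1})\circ\delta_{1}(a)=u_{23}\,\delta_{1}(a)_{13},$$ $$(\delta_{1}\otimes\psi-\omega\otimes\delta_{1})(u)=u_{23}u_{13}-u_{12}u_{23}.$$ In this case, $$\Delta(a)=\alpha(u^{1})\otimes u^{2}\,\psi\beta^{-1}(a)+\delta_{1}(a)=\omega\alpha^{-1}(a)u^{1}\otimes\beta(u^{2})+\delta_{2}(a).$$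
   Context: $K$ is a field; everything is $K$-linear; elements of $A\otimes A$ are written $u=u^1\otimes u^2$ with summation understood, and juxtaposition of maps denotes composition. A BiHom-associative algebra $(A,\mu,\alpha,\beta)$ is a vector space $A$ with linear maps $\mu:A\otimes A\to A$, $\mu(a\otimes b)=ab$, and $\alpha,\beta:A\to A$ with $\alpha\beta=\beta\alpha$, $\alpha(ab)=\alpha(a)\alpha(b)$, $\beta(ab)=\beta(a)\beta(b)$, $\alpha(a)(bc)=(ab)\beta(c)$. It is unitary with unit $1\in A$ if $\alpha(1)=\beta(1)=1$, $a1=\alpha(a)$, $1a=\beta(a)$. Actions of $A$ on $A\otimes A$: $a\triangleright(x\otimes y)=\omega(a)x\otimes\beta(y)$ and $(x\otimes y)\triangleleft a=\alpha(x)\otimes y\psi(a)$. A BiHom-derivation is a linear map $\delta:A\to A\otimes A$ with $(F\otimes F)\circ\delta=\delta\circ F$ for $F\in\{\alpha,\beta,\psi,\omega\}$ and $\delta(ab)=a\triangleright\delta(b)+\delta(a)\triangleleft b$ for all $a,b\in A$. $\Delta$ is a covariant BiHom-derivation with respect to $(\delta_1,\delta_2)$ if for all $a,b\in A$: $\Delta(ab)=\Delta(a)\triangleleft b+a\triangleright\delta_{1}(b)=a\triangleright\Delta(b)+\delta_{2}(a)\triangleleft b$. $\Delta$ is coassociative (in the BiHom sense) if $(\Delta\otimes\psi)\circ\Delta=(\omega\otimes\Delta)\circ\Delta$. Notation: for $r,s\in A\otimes A$ (independent copies if equal), $r_{12}s_{23}=\alpha(r^{1})\otimes r^{2}s^{1}\otimes\beta(s^{2})$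 and $r_{23}s_{13}=\beta\omega(s^{1})\otimes\alpha(r^{1})\otimes r^{2}\psi(s^{2})$. In particular, writing $\delta_1(a)=a_{[1]}\otimes a_{[2]}$, one has $u_{23}\,\delta_1(a)_{13}=\beta\omega(a_{[1]})\otimes\alpha(u^{1})\otimes u^{2}\psi(a_{[2]})$.
   Formalization: The second condition is corrected to u_23 δ1(β^{-1}(a))_13 (as printed, with δ1(a), the claim fails when β ≠ id), and the formulas for Δ(a) are part of the conditions on u, since otherwise the converse fails. *)

(* Defs.v *)
From HB Require Import structures.
From mathcomp Require Import all_boot all_algebra generic_quotient.
From mathcomp Require Import boolp.
From mathcomp.multinomials Require Import freeg.

Set Implicit Arguments.
Unset Strict Implicit.
Unset Printing Implicit Defensive.

Import GRing.Theory.
Local Open Scope ring_scope.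
Local Open Scope quotient_scope.

Reserved Notation "x ⊗ y" (at level 40, left associativity).

Section FreegLift.
Variables (R : nzRingType) (T : choiceType) (M : lmodType R) (f : T -> M).

Fact fglift_zmod_morphism : zmod_morphism (fglift f : {freeg T / R} -> M).
Proof. exact: lift_is_additive. Qed.
HB.instance Definition _ :=
  GRing.isZmodMorphism.Build {freeg T / R} M (fglift f) fglift_zmod_morphism.

Fact fglift_scalable : scalable (fglift f : {freeg T / R} -> M).
Proof.
move=> a x; rewrite -[in LHS](freeg_sumE x) -[in RHS](freeg_sumE x).
rewrite (raddf_sum ( *:%R a)) !raddf_sum; apply: eq_bigr => k _ /=.
have ->: a *: Freeg [:: (coeff k x, k)] = Freeg [:: (a * coeff k x, k)].
  by apply/eqP/freeg_eqP => l; rewrite coeffZ !coeffU mulrA.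
by rewrite !liftU scalerA.
Qed.
HB.instance Definition _ :=
  GRing.isScalable.Build R {freeg T / R} M *:%R (fglift f) fglift_scalable.

End FreegLift.

(* The tensor product of two vector spaces, as the quotient of the free vector
   space on V * W by the subspace spanned by the bilinearity relators.        *)

Section TensorProduct.
Variables (K : fieldType) (V W : lmodType K).

Local Notation free := {freeg (V * W)%type / K}.
Local Notation gen v w := (Freeg [:: (1, (v, w))] : free).

Inductive tens_relator : free -> Prop :=
| Tens_relator_l a v1 v2 w :
    tens_relator (gen (a *: v1 + v2) w - (a *: gen v1 w + gen v2 w))
| Tens_relator_r a v w1 w2 :
    tens_relator (gen v (a *: w1 + w2) - (a *: gen v w1 + gen v w2)).

Definition tens_null : {pred free} := fun x =>
  `[< forall S : {pred free}, submod_closed S ->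
        (forall r, tens_relator r -> r \in S) -> x \in S >].

Lemma tens_relator_null r : tens_relator r -> r \in tens_null.
Proof. by move=> rP; apply/asboolP => S _; apply. Qed.

Lemma tens_null_submod_closed : submod_closed tens_null.
Proof.
split=> [|a x y /asboolP xN /asboolP yN]; apply/asboolP => S Scl rS.
  by case: Scl.
by case: (Scl) => _; apply; [apply: xN|apply: yN].
Qed.

HB.instance Definition _ :=
  GRing.isSubmodClosed.Build K free tens_null tens_null_submod_closed.

Definition tens : Type := Quotient.quot tens_null.
HB.instance Definition _ := GRing.Zmodule.on tens.

Definition tens_pi (x : free) : tens := \pi_(Quotient.quot tens_null) x.
Definition tens_repr (t : tens) : free := repr (t : Quotient.quot tens_null).

Lemma tens_reprK : cancel tens_repr tens_pi.
Proof. exact: reprK. Qed.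

Lemma tens_piP x y : (tens_pi x = tens_pi y) <-> (x - y \in tens_null).
Proof. by rewrite Quotient.idealrBE; split=> /eqP. Qed.

Lemma tens_piD : {morph tens_pi : x y / x + y}.
Proof. exact: (raddfD (\pi_(Quotient.quot tens_null))). Qed.

Definition tens_scale (a : K) (t : tens) : tens := tens_pi (a *: tens_repr t).

Lemma tens_scale_pi a x : tens_scale a (tens_pi x) = tens_pi (a *: x).
Proof.
apply/tens_piP; rewrite -scalerBr rpredZ //.
by apply/tens_piP; rewrite tens_reprK.
Qed.

Fact tens_scaleA a b t : tens_scale a (tens_scale b t) = tens_scale (a * b) t.
Proof. by rewrite -[t]tens_reprK !tens_scale_pi scalerA. Qed.
Fact tens_scale1 : left_id 1 tens_scale.
Proof. by move=> t; rewrite -[t]tens_reprK tens_scale_pi scale1r. Qed.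
Fact tens_scaleDr : right_distributive tens_scale +%R.
Proof.
move=> a s t; rewrite -[s]tens_reprK -[t]tens_reprK.
by rewrite -tens_piD !tens_scale_pi -tens_piD scalerDr.
Qed.
Fact tens_scaleDl t : {morph tens_scale^~ t : a b / a + b}.
Proof.
by move=> a b; rewrite -[t]tens_reprK !tens_scale_pi -tens_piD scalerDl.
Qed.

HB.instance Definition _ := GRing.Zmodule_isLmodule.Build K tens
  tens_scaleA tens_scale1 tens_scaleDr tens_scaleDl.

Lemma tens_pi_linear : linear tens_pi.
Proof. by move=> a x y; rewrite tens_piD -tens_scale_pi. Qed.
HB.instance Definition _ := GRing.isLinear.Build K free tens *:%R tens_pi
  tens_pi_linear.

Definition tmul (v : V) (w : W) : tens := tens_pi (gen v w).

Lemma tmul_bilinear : bilinear_for *:%R *:%R tmul.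
Proof.
split=> [w a v1 v2|v a w1 w2]; rewrite /tmul -tens_pi_linear;
  by apply/tens_piP/tens_relator_null; constructor.
Qed.
HB.instance Definition _ :=
  bilinear_isBilinear.Build K V W tens *:%R *:%R tmul tmul_bilinear.

Lemma tens_sum (t : tens) :
  exists s : seq (V * W), t = \sum_(p <- s) tmul p.1 p.2.
Proof.
exists [seq (coeff p (tens_repr t) *: p.1, p.2) | p <- dom (tens_repr t)].
rewrite big_map -[t in LHS]tens_reprK -[X in tens_pi X]freeg_sumE raddf_sum.
apply: eq_bigr => -[v w] _ /=; set c := coeff _ _.
have ->: Freeg [:: (c, (v, w))] = c *: gen v w.
  by apply/eqP/freeg_eqP => k; rewrite coeffZ !coeffU mul1r.
rewrite linearZ; have := tmul_bilinear.1 w c v 0.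
rewrite addr0 => ->; rewrite -[tmul 0 w]/(applyr tmul w 0).
by rewrite linear0 addr0.
Qed.

(* [tlift f] is the linear map induced by f. It is a total operation, only
   meaningful for bilinear f: the value then does not depend on the
   representative (tliftE, tlift_linear).                                     *)
Section Lift.
Variables (U : lmodType K) (f : V -> W -> U).

Local Notation lift := (fglift (fun p : V * W => f p.1 p.2)).

Definition tlift (t : tens) : U := lift (tens_repr t).

Hypothesis f_bilinear : bilinear_for *:%R *:%R f.

Let lift_null x : x \in tens_null -> lift x = 0.
Proof.
move=> /asboolP /(_ [pred x | lift x == 0]) xS; apply/eqP; apply: xS => [|r].
  split=> [|a u v]; rewrite !inE ?linear0 //.
  by move=> /eqP lu /eqP lv; rewrite linearP /= lu lv scaler0 addr0.
case=> [a v1 v2 w|a v w1 w2]; rewrite inE linearB linearP /= !liftU !scale1r /=.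
- by rewrite (f_bilinear.1 w a v1 v2) subrr.
- by rewrite (f_bilinear.2 v a w1 w2) subrr.
Qed.

Let tlift_pi x : tlift (tens_pi x) = lift x.
Proof.
apply/eqP; rewrite -subr_eq0 -raddfB; apply/eqP/lift_null.
by apply/tens_piP; rewrite tens_reprK.
Qed.

Lemma tliftE v w : tlift (tmul v w) = f v w.
Proof. by rewrite tlift_pi liftU scale1r. Qed.

Lemma tlift_linear : linear tlift.
Proof.
move=> a s t; rewrite -[s]tens_reprK -[t]tens_reprK -tens_pi_linear !tlift_pi.
exact: linearP.
Qed.

Lemma tlift_sum (s : seq (V * W)) :
  tlift (\sum_(p <- s) tmul p.1 p.2) = \sum_(p <- s) f p.1 p.2.
Proof.
pose L := GRing.isLinear.Build K tens U *:%R tlift tlift_linear.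
pose l : {linear tens -> U} := HB.pack tlift L.
by rewrite -[LHS]/(l _) linear_sum; apply: eq_bigr => p _; exact: tliftE.
Qed.

End Lift.

End TensorProduct.

Arguments tens {K} V W.
Arguments tlift {K V W U} f t.

Notation "x ⊗ y" := (tmul x y) : ring_scope.

Section TensorMaps.
Variable K : fieldType.

(* The map f ⊗ g, meaningful for linear f and g. *)
Definition tmap (V W V' W' : lmodType K) (f : V -> V') (g : W -> W') :
  tens V W -> tens V' W' := tlift (fun v w => f v ⊗ g w).

Definition tassoc (U V W : lmodType K) :
  tens (tens U V) W -> tens U (tens V W) :=
  tlift (fun t w => tlift (fun u v => u ⊗ (v ⊗ w)) t).

Section Theory.
Variables (V W V' W' : lmodType K) (f : {linear V -> V'}) (g : {linear W -> W'}).

Let tmap_bilinear : bilinear_for *:%R *:%R (fun v w => f v ⊗ g w).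
Proof.
split=> [y a x1 x2|x a y1 y2] /=; rewrite linearP.
- exact: (tmul_bilinear _ _).1.
- exact: (tmul_bilinear _ _).2.
Qed.

Lemma tmapE v w : tmap f g (v ⊗ w) = f v ⊗ g w.
Proof. exact: (tliftE tmap_bilinear). Qed.

Lemma tmap_linear : linear (tmap f g).
Proof. exact: (tlift_linear tmap_bilinear). Qed.

End Theory.

Section Assoc.
Variables U V W : lmodType K.

Let assoc_inner (w : W) :
  bilinear_for *:%R *:%R (fun (u : U) (v : V) => u ⊗ (v ⊗ w)).
Proof.
split=> [y a x1 x2|y a x1 x2]; first exact: (tmul_bilinear _ _).1.
by rewrite (tmul_bilinear _ _).1; exact: (tmul_bilinear _ _).2.
Qed.

Let assoc_outer : bilinear_for *:%R *:%R
  (fun (t : tens U V) (w : W) => tlift (fun u v => u ⊗ (v ⊗ w)) t).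
Proof.
split=> [w|t a x y /=]; first exact: tlift_linear (assoc_inner w).
have [s ->] := tens_sum t.
rewrite !tlift_sum // scaler_sumr -big_split; apply: eq_bigr => p _ /=.
by rewrite (tmul_bilinear _ _).2; exact: (tmul_bilinear _ _).2.
Qed.

Lemma tassocE (u : U) (v : V) (w : W) : tassoc ((u ⊗ v) ⊗ w) = u ⊗ (v ⊗ w).
Proof.
by rewrite /tassoc (tliftE assoc_outer) (tliftE (assoc_inner w)).
Qed.

Lemma tassoc_linear : linear (@tassoc U V W).
Proof. exact: (tlift_linear assoc_outer). Qed.

End Assoc.

End TensorMaps.

Section BiHom.
Variables (K : fieldType) (A : lmodType K) (mu : {linear tens A A -> A}).
Variables (alpha beta psi omega : {linear A -> A}).

Local Notation "a ∙ b" := (mu (a ⊗ b)) (at level 40, left associativity).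

Definition preserves_mul (F : A -> A) := forall a b, F (a ∙ b) = F a ∙ F b.

Definition bihom_associative : Prop :=
  [/\ forall a, alpha (beta a) = beta (alpha a),
      preserves_mul alpha,
      preserves_mul beta
    & forall a b c, alpha a ∙ (b ∙ c) = (a ∙ b) ∙ beta c].

Definition bihom_unit (one : A) : Prop :=
  [/\ alpha one = one,
      beta one = one,
      forall a, a ∙ one = alpha a
    & forall a, one ∙ a = beta a].

Definition lact (a : A) (t : tens A A) : tens A A :=
  tlift (fun x y => (omega a ∙ x) ⊗ beta y) t.

Definition ract (t : tens A A) (a : A) : tens A A :=
  tlift (fun x y => alpha x ⊗ (y ∙ psi a)) t.

Local Notation "a ▷ t" := (lact a t) (at level 40).
Local Notation "t ◁ a" := (ract t a) (at level 40).

Definition intertwines (F : A -> A) (D : A -> tens A A) : Prop :=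
  forall a, tmap F F (D a) = D (F a).

Definition bihom_equivariant (D : A -> tens A A) : Prop :=
  [/\ intertwines alpha D, intertwines beta D,
      intertwines psi D & intertwines omega D].

Definition bihom_derivation (delta : {linear A -> tens A A}) : Prop :=
  bihom_equivariant delta /\
  forall a b, delta (a ∙ b) = a ▷ delta b + delta a ◁ b.

Definition covariant (delta1 delta2 Delta : {linear A -> tens A A}) : Prop :=
  forall a b, Delta (a ∙ b) = Delta a ◁ b + a ▷ delta1 b
           /\ Delta (a ∙ b) = a ▷ Delta b + delta2 a ◁ b.

Definition coassociative (Delta : {linear A -> tens A A}) : Prop :=
  forall a, tassoc (tmap Delta psi (Delta a)) = tmap omega Delta (Delta a).

(* r_{12} s_{23} and r_{23} s_{13}, in A ⊗ (A ⊗ A) *)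
Definition mul_12_23 (r s : tens A A) : tens A (tens A A) :=
  tlift (fun r1 r2 =>
    tlift (fun s1 s2 => alpha r1 ⊗ ((r2 ∙ s1) ⊗ beta s2)) s) r.

Definition mul_23_13 (r s : tens A A) : tens A (tens A A) :=
  tlift (fun r1 r2 =>
    tlift (fun s1 s2 => beta (omega s1) ⊗ (alpha r1 ⊗ (r2 ∙ psi s2))) s) r.

End BiHom.

(* Main.v *)
Require Import Defs.
From HB Require Import structures.
From mathcomp Require Import all_boot all_algebra.

Set Implicit Arguments.
Unset Strict Implicit.
Unset Printing Implicit Defensive.

Import GRing.Theory.
Local Open Scope ring_scope.

(** Write [D f t = (f ⊗ psi)(t) - (omega ⊗ f)(t)] for the coassociativity defect
    ([coassoc_defect]), so that [Delta] is coassociative when [D Delta] vanishes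
    on every [Delta a].

    The element of the theorem is [u = Delta 1]. A BiHom-derivation kills [1], so
    the two covariance rules at [1 b] and [a 1] give
    [Delta a = u ◁ beta^-1(a) + delta1 a = alpha^-1(a) ▷ u + delta2 a], and the
    condition on [delta1 - delta2] says that the two expressions agree. As
    [Delta] commutes with the four structure maps and these fix [1], the tensor
    [u] is invariant under [F ⊗ F] for each of them. Conversely, an [u] with
    these formulas satisfies [Delta 1 = (alpha ⊗ alpha)(u)]; invariance of
    [Delta 1] and injectivity of [alpha ⊗ alpha] force [Delta 1 = u], so the same
    invariances are available, and they are what turns the rules
    [(t ◁ a) ◁ beta b = (alpha ⊗ alpha)(t) ◁ ab] and
    [alpha a ▷ (b ▷ t) = ab ▷ (beta ⊗ beta)(t)] into covariance.

    Coassociativity is controlled by one identity, [coassoc_defect_total]: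
    [D Delta (Delta (beta a))] is the sum of the image of [D Delta u] under a
    linear map depending on [a], and of
    [D delta1 (delta1 (beta a)) - u_23 delta1(a)_13]. Moreover
    [D Delta u = D delta1 u + u_12 u_23 - u_23 u_13] ([coassoc_defect_u]). If
    both remaining conditions on [u] hold, everything vanishes. If [Delta] is
    coassociative, then [D Delta u = D Delta (Delta 1) = 0], which is the third
    condition, and the identity then leaves the second one. The identity itself
    combines the effect of replacing [delta1] by [Delta] in the defect
    ([coassoc_defect_perturb]) with the behaviour of the defect under the right
    action ([coassoc_defect_ract]). *)

(** * Tensor products of vector spaces *)

Section Tensor.
Variable K : fieldType.

Section Universal.
Variables V W : lmodType K.

Lemma tmulDl (v v' : V) (w : W) : (v + v') ⊗ w = v ⊗ w + v' ⊗ w.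
Proof. exact: linearDl. Qed.

Lemma tmulDr (v : V) (w w' : W) : v ⊗ (w + w') = v ⊗ w + v ⊗ w'.
Proof. exact: linearDr. Qed.

Lemma tmulPl a (v v' : V) (w : W) :
  (a *: v + v') ⊗ w = a *: (v ⊗ w) + v' ⊗ w.
Proof. exact: (tmul_bilinear V W).1. Qed.

Lemma tmulPr a (v : V) (w w' : W) :
  v ⊗ (a *: w + w') = a *: (v ⊗ w) + v ⊗ w'.
Proof. exact: (tmul_bilinear V W).2. Qed.

(** Scalars are absorbed by the pure tensors, so additivity is all that an
    identity between linear maps has to be checked for. *)
Lemma tens_ind (P : tens V W -> Prop) :
    (forall v w, P (v ⊗ w)) -> (forall s t, P s -> P t -> P (s + t)) ->
  forall t, P t.
Proof.
move=> Pmul PD t; have [s ->] := tens_sum t.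
elim/big_ind: _ => //.
have <- : 0 ⊗ 0 = 0 :> tens V W.
  by apply: (addIr (0 ⊗ 0)); rewrite -tmulDl !add0r.
exact: Pmul.
Qed.

End Universal.

HB.instance Definition _ (V W V' W' : lmodType K) (f : {linear V -> V'})
    (g : {linear W -> W'}) :=
  GRing.isLinear.Build K (tens V W) (tens V' W') *:%R (tmap f g)
    (tmap_linear f g).

HB.instance Definition _ (U V W : lmodType K) :=
  GRing.isLinear.Build K (tens (tens U V) W) (tens U (tens V W)) *:%R
    (@tassoc K U V W) (@tassoc_linear K U V W).

Lemma tmap_cancel (V : lmodType K) (f : {linear V -> V}) (fV : V -> V) :
  cancel f fV -> cancel fV f -> injective (tmap f f).
Proof.
move=> fK fVK.
pose L := GRing.isLinear.Build K V V *:%R fV (can2_linear fK fVK).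
pose g : {linear V -> V} := HB.pack fV L.
apply: (can_inj (g := tmap g g)).
elim/tens_ind => [v w|s t IHs IHt]; first by rewrite !tmapE /= !fK.
by rewrite (raddfD (tmap f f)) (raddfD (tmap g g)) /= IHs IHt.
Qed.

(** Writing one tensor as a finite sum of pure ones turns an iterated lift into a
    sum of lifts in the other; this gives well-definedness of the products
    [r_12 s_23] and [r_23 s_13] on both arguments. *)
Section DoubleLift.
Variables (V W V' W' U : lmodType K) (g : V -> W -> V' -> W' -> U).
Hypothesis g_bilinear1 : forall v' w',
  bilinear_for *:%R *:%R (fun v w => g v w v' w').
Hypothesis g_bilinear2 : forall v w, bilinear_for *:%R *:%R (g v w).

Let dlift (r : tens V W) (s : tens V' W') :=
  tlift (fun v w => tlift (g v w) s) r.

Let inner_bilinear s : bilinear_for *:%R *:%R (fun v w => tlift (g v w) s).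
Proof.
have [q ->] := tens_sum s.
split=> [w a x y|v a x y] /=; rewrite !tlift_sum // scaler_sumr -big_split;
  apply: eq_bigr => p _ /=.
- exact: (g_bilinear1 p.1 p.2).1.
- exact: (g_bilinear1 p.1 p.2).2.
Qed.

Lemma dliftE v w v' w' : dlift (v ⊗ w) (v' ⊗ w') = g v w v' w'.
Proof. by rewrite /dlift tliftE // tliftE. Qed.

Lemma dliftDl r r' s : dlift (r + r') s = dlift r s + dlift r' s.
Proof.
by have /= := tlift_linear (inner_bilinear s) 1 r r'; rewrite !scale1r.
Qed.

Lemma dliftDr r s s' : dlift r (s + s') = dlift r s + dlift r s'.
Proof.
have [q ->] := tens_sum r; rewrite /dlift !tlift_sum // -big_split.
apply: eq_bigr => p _ /=.
by have /= := tlift_linear (g_bilinear2 p.1 p.2) 1 s s'; rewrite !scale1r.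
Qed.

End DoubleLift.

End Tensor.

Section BiHomTheory.
Variables (K : fieldType) (A : lmodType K) (mu : {linear tens A A -> A}).
Variables alpha beta psi omega : {linear A -> A}.

Local Notation "a ∙ b" := (mu (a ⊗ b)) (at level 40, left associativity).
Local Notation "a ▷ t" := (lact mu beta omega a t) (at level 40).
Local Notation "t ◁ a" := (ract mu alpha psi t a) (at level 40).
Local Notation mul_12_23 := (mul_12_23 mu alpha beta).
Local Notation mul_23_13 := (mul_23_13 mu alpha beta psi omega).

(** * Actions and leg products on pure tensors *)

Definition mull (a : A) : A -> A := fun x => a ∙ x.
Definition mulr (b : A) : A -> A := fun x => x ∙ b.

Fact mull_linear a : linear (mull a).
Proof. by move=> c x y; rewrite /mull tmulPr linearP. Qed.
HB.instance Definition _ a :=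
  GRing.isLinear.Build K A A *:%R (mull a) (mull_linear a).

Fact mulr_linear b : linear (mulr b).
Proof. by move=> c x y; rewrite /mulr tmulPl linearP. Qed.
HB.instance Definition _ b :=
  GRing.isLinear.Build K A A *:%R (mulr b) (mulr_linear b).

Lemma lactE a x y : a ▷ (x ⊗ y) = (omega a ∙ x) ⊗ beta y.
Proof. exact: (tmapE (mull (omega a)) beta). Qed.

Lemma lactD a s t : a ▷ (s + t) = a ▷ s + a ▷ t.
Proof. exact: (raddfD (tmap (mull (omega a)) beta)). Qed.

Lemma ractE x y a : (x ⊗ y) ◁ a = alpha x ⊗ (y ∙ psi a).
Proof. exact: (tmapE alpha (mulr (psi a))). Qed.

Lemma ractD s t a : (s + t) ◁ a = s ◁ a + t ◁ a.
Proof. exact: (raddfD (tmap alpha (mulr (psi a)))). Qed.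

Section Products.

Let g12 r1 r2 s1 s2 := alpha r1 ⊗ ((r2 ∙ s1) ⊗ beta s2).
Let g12_bilinear1 s1 s2 :
  bilinear_for *:%R *:%R (fun r1 r2 => g12 r1 r2 s1 s2).
Proof. by split=> z a x y; rewrite /g12 /= ?(tmulPl, tmulPr, linearP). Qed.
Let g12_bilinear2 r1 r2 : bilinear_for *:%R *:%R (g12 r1 r2).
Proof. by split=> z a x y; rewrite /g12 /= ?(tmulPl, tmulPr, linearP). Qed.

Lemma mul_12_23E r1 r2 s1 s2 :
  mul_12_23 (r1 ⊗ r2) (s1 ⊗ s2) = alpha r1 ⊗ ((r2 ∙ s1) ⊗ beta s2).
Proof. exact: (dliftE g12_bilinear1 g12_bilinear2). Qed.

Lemma mul_12_23Dl r r' s :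
  mul_12_23 (r + r') s = mul_12_23 r s + mul_12_23 r' s.
Proof. exact: (dliftDl g12_bilinear1 g12_bilinear2). Qed.

Lemma mul_12_23Dr r s s' :
  mul_12_23 r (s + s') = mul_12_23 r s + mul_12_23 r s'.
Proof. exact: (dliftDr g12_bilinear1 g12_bilinear2). Qed.

Let g23 r1 r2 s1 s2 := beta (omega s1) ⊗ (alpha r1 ⊗ (r2 ∙ psi s2)).
Let g23_bilinear1 s1 s2 :
  bilinear_for *:%R *:%R (fun r1 r2 => g23 r1 r2 s1 s2).
Proof. by split=> z a x y; rewrite /g23 /= ?(tmulPl, tmulPr, linearP). Qed.
Let g23_bilinear2 r1 r2 : bilinear_for *:%R *:%R (g23 r1 r2).
Proof. by split=> z a x y; rewrite /g23 /= ?(tmulPl, tmulPr, linearP). Qed.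

Lemma mul_23_13E r1 r2 s1 s2 :
  mul_23_13 (r1 ⊗ r2) (s1 ⊗ s2)
    = beta (omega s1) ⊗ (alpha r1 ⊗ (r2 ∙ psi s2)).
Proof. exact: (dliftE g23_bilinear1 g23_bilinear2). Qed.

Lemma mul_23_13Dl r r' s :
  mul_23_13 (r + r') s = mul_23_13 r s + mul_23_13 r' s.
Proof. exact: (dliftDl g23_bilinear1 g23_bilinear2). Qed.

Lemma mul_23_13Dr r s s' :
  mul_23_13 r (s + s') = mul_23_13 r s + mul_23_13 r s'.
Proof. exact: (dliftDr g23_bilinear1 g23_bilinear2). Qed.

End Products.

(** * The actions over a BiHom-associative algebra *)

Section Actions.
Hypothesis A_assoc : bihom_associative mu alpha beta.

Lemma ract_ract t a b : psi (beta b) = beta (psi b) -> preserves_mul mu psi ->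
  (t ◁ a) ◁ beta b = tmap alpha alpha t ◁ (a ∙ b).
Proof.
move=> psi_beta psiM; have [_ _ _ assoc] := A_assoc.
elim/tens_ind: t => [x y|s t IHs IHt]; last by rewrite raddfD !ractD IHs IHt.
by rewrite tmapE !ractE psi_beta psiM assoc.
Qed.

Lemma lact_lact t a b :
    omega (alpha a) = alpha (omega a) -> preserves_mul mu omega ->
  alpha a ▷ (b ▷ t) = (a ∙ b) ▷ tmap beta beta t.
Proof.
move=> omega_alpha omegaM; have [_ _ _ assoc] := A_assoc.
elim/tens_ind: t => [x y|s t IHs IHt]; last by rewrite raddfD !lactD IHs IHt.
by rewrite tmapE !lactE omega_alpha omegaM assoc.
Qed.

Variable one : A.
Hypothesis A_unit : bihom_unit mu alpha beta one.

Lemma ract1 t : psi one = one -> t ◁ one = tmap alpha alpha t.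
Proof.
move=> psi1; have [_ _ mul_one _] := A_unit.
elim/tens_ind: t => [x y|s t IHs IHt]; last by rewrite raddfD ractD IHs IHt.
by rewrite tmapE ractE psi1 mul_one.
Qed.

Lemma lact1 t : omega one = one -> one ▷ t = tmap beta beta t.
Proof.
move=> omega1; have [_ _ _ one_mul] := A_unit.
elim/tens_ind: t => [x y|s t IHs IHt]; last by rewrite raddfD lactD IHs IHt.
by rewrite tmapE lactE omega1 one_mul.
Qed.

(** As for ordinary derivations, [1 ∙ 1 = 1] makes the value at [1] its own
    double. *)
Lemma bihom_derivation1 (delta : {linear A -> tens A A}) :
    psi one = one -> omega one = one ->
  bihom_derivation mu alpha beta psi omega delta -> delta one = 0.
Proof.
move=> psi1 omega1 [[deltaA deltaB _ _] deltaM].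
have [alpha1 beta1 mul_one _] := A_unit.
have := deltaM one one.
rewrite mul_one alpha1 lact1 // ract1 // deltaA deltaB alpha1 beta1.
by rewrite -[LHS]addr0 => /addrI.
Qed.

End Actions.

(** * The coassociativity defect *)

(** [(f ⊗ psi - omega ⊗ f)(t)]: kept as a function of an arbitrary tensor
    because both [t = f a] and [t = u] occur. *)
Definition coassoc_defect (f : A -> tens A A) (t : tens A A) :
    tens A (tens A A) :=
  tassoc (tmap f psi t) - tmap omega f t.

Lemma coassoc_defectE (f : {linear A -> tens A A}) x y :
  coassoc_defect f (x ⊗ y) = tassoc (f x ⊗ psi y) - omega x ⊗ f y.
Proof. by rewrite /coassoc_defect !tmapE. Qed.

Lemma coassoc_defectD (f : {linear A -> tens A A}) s t :
  coassoc_defect f (s + t) = coassoc_defect f s + coassoc_defect f t.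
Proof.
rewrite /coassoc_defect (raddfD (tmap f psi)) (raddfD (tmap omega f)).
by rewrite raddfD /= opprD addrACA.
Qed.

Lemma coassociativeP (f : {linear A -> tens A A}) :
  coassociative psi omega f <-> forall a, coassoc_defect f (f a) = 0.
Proof.
by split=> Hf a; [rewrite /coassoc_defect Hf subrr | apply/subr0_eq/Hf].
Qed.

Lemma tassoc_ract u x y : psi (beta y) = beta (psi y) ->
  tassoc ((u ◁ x) ⊗ psi (beta y)) = mul_12_23 u (psi x ⊗ psi y).
Proof.
move=> psi_beta; elim/tens_ind: u => [u1 u2|s t IHs IHt].
  by rewrite ractE tassocE psi_beta mul_12_23E.
by rewrite ractD tmulDl raddfD /= IHs IHt mul_12_23Dl.
Qed.

Lemma tmul_ract u x y : omega (beta x) = beta (omega x) ->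
  omega (beta x) ⊗ (u ◁ y) = mul_23_13 u (x ⊗ y).
Proof.
move=> omega_beta; elim/tens_ind: u => [u1 u2|s t IHs IHt].
  by rewrite ractE omega_beta mul_23_13E.
by rewrite ractD tmulDr IHs IHt mul_23_13Dl.
Qed.

Lemma tmul_lact x y s :
  alpha (omega x) ⊗ (y ▷ s) = mul_12_23 (omega x ⊗ omega y) s.
Proof.
elim/tens_ind: s => [s1 s2|s t IHs IHt]; first by rewrite lactE mul_12_23E.
by rewrite lactD tmulDr IHs IHt mul_12_23Dr.
Qed.

Lemma tassoc_mulr s z c :
  tassoc (tmap alpha alpha s ⊗ (z ∙ c))
    = tmap alpha (tmap alpha (mulr c)) (tassoc (s ⊗ z)).
Proof.
elim/tens_ind: s => [x y|s t IHs IHt].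
  by rewrite !tmapE !tassocE tmapE /= tmapE.
by rewrite (raddfD (tmap alpha alpha)) !tmulDl !raddfD /= IHs IHt.
Qed.

Section Perturbation.
Hypothesis psi_beta : forall a, psi (beta a) = beta (psi a).
Hypothesis omega_alpha : forall a, omega (alpha a) = alpha (omega a).
Hypothesis omega_beta : forall a, omega (beta a) = beta (omega a).
Hypothesis psiM : preserves_mul mu psi.
Variables (u : tens A A) (delta Delta : {linear A -> tens A A}).

Hypothesis Delta_beta : forall a, Delta (beta a) = u ◁ a + delta (beta a).

(** Replacing [delta] by [Delta = delta + u ◁ beta^-1(-)] changes the defect by
    two terms, one for each place where the inner map is applied: in the left
    leg [u ◁ -] produces a product [u_12 t_23], in the right leg [u_23 t_13].
    Taking the argument in the image of [beta ⊗ beta] absorbs [beta^-1]. *)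
Lemma coassoc_defect_perturb t :
  coassoc_defect Delta (tmap beta beta t) =
    coassoc_defect delta (tmap beta beta t)
    + (mul_12_23 u (tmap psi psi t) - mul_23_13 u t).
Proof.
elim/tens_ind: t => [x y|s t IHs IHt].
  rewrite !tmapE !coassoc_defectE !Delta_beta tmulDl tmulDr raddfD /=.
  rewrite tassoc_ract // tmul_ract // opprD addrACA.
  by rewrite addrC.
rewrite (raddfD (tmap beta beta)) (raddfD (tmap psi psi)) /=.
rewrite !coassoc_defectD IHs IHt mul_12_23Dr mul_23_13Dr opprD.
by rewrite addrACA; congr (_ + _); exact: addrACA.
Qed.

Hypothesis Delta_alpha : intertwines alpha Delta.
Hypothesis DeltaM : forall a b, Delta (a ∙ b) = Delta a ◁ b + a ▷ delta b.

(** The right action on the argument can be pulled out of the defect, up to the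
    term that the product rule for [Delta] in the right leg leaves behind. *)
Lemma coassoc_defect_ract t a :
  coassoc_defect Delta (t ◁ a) =
    tmap alpha (tmap alpha (mulr (psi (psi a)))) (coassoc_defect Delta t)
    - mul_12_23 (tmap omega omega t) (delta (psi a)).
Proof.
elim/tens_ind: t => [x y|s t IHs IHt].
  rewrite ractE tmapE !coassoc_defectE psiM -Delta_alpha tassoc_mulr DeltaM.
  rewrite omega_alpha tmulDr tmul_lact raddfB /=.
  by rewrite [tmap alpha _ (_ ⊗ Delta y)]tmapE opprD addrA.
rewrite ractD (raddfD (tmap omega omega)) /= !coassoc_defectD IHs IHt.
rewrite mul_12_23Dl opprD.
rewrite [in RHS](raddfD (tmap alpha (tmap alpha (mulr (psi (psi a)))))) /=.
by rewrite addrACA.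
Qed.

Hypothesis delta_beta : intertwines beta delta.
Hypothesis delta_psi : intertwines psi delta.
Hypothesis u_beta : tmap beta beta u = u.
Hypothesis u_psi : tmap psi psi u = u.
Hypothesis u_omega : tmap omega omega u = u.

Lemma coassoc_defect_u :
  coassoc_defect Delta u =
    coassoc_defect delta u + (mul_12_23 u u - mul_23_13 u u).
Proof. by have := coassoc_defect_perturb u; rewrite u_beta u_psi. Qed.

(** [coassoc_defect_ract] is applied to the summand [u ◁ a] of [Delta (beta a)]
    and [coassoc_defect_perturb] to the summand [delta (beta a)]; the terms
    [u_12 delta(psi(a))_23] that they produce cancel. *)
Lemma coassoc_defect_total a :
  coassoc_defect Delta (Delta (beta a)) =
    tmap alpha (tmap alpha (mulr (psi (psi a)))) (coassoc_defect Delta u)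
    + (coassoc_defect delta (delta (beta a)) - mul_23_13 u (delta a)).
Proof.
rewrite Delta_beta coassoc_defectD coassoc_defect_ract u_omega.
rewrite -delta_beta coassoc_defect_perturb delta_psi -addrA; congr (_ + _).
by rewrite addrCA addKr.
Qed.

End Perturbation.

End BiHomTheory.

(** * The classification of coassociative covariant BiHom-derivations *)

(* The second condition reads u_{23} delta1(beta^{-1}(a))_{13}: with
   u_{23} delta1(a)_{13} instead, the equivalence fails when beta <> id.     *)
Theorem theorem2p23 (K : fieldType) (A : lmodType K)
    (mu : {linear tens A A -> A}) (alpha beta psi omega : {linear A -> A})
    (one : A) (alphaV betaV : A -> A)
    (A_assoc : bihom_associative mu alpha beta)
    (A_unit : bihom_unit mu alpha beta one)
    (alphaK : cancel alpha alphaV) (alphaVK : cancel alphaV alpha)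
    (betaK : cancel beta betaV) (betaVK : cancel betaV beta)
    (psi_alpha : forall a, psi (alpha a) = alpha (psi a))
    (psi_beta : forall a, psi (beta a) = beta (psi a))
    (omega_alpha : forall a, omega (alpha a) = alpha (omega a))
    (omega_beta : forall a, omega (beta a) = beta (omega a))
    (psiM : preserves_mul mu psi) (omegaM : preserves_mul mu omega)
    (psi1 : psi one = one) (omega1 : omega one = one)
    (delta1 delta2 Delta : {linear A -> tens A A})
    (delta1P : bihom_derivation mu alpha beta psi omega delta1)
    (delta2P : bihom_derivation mu alpha beta psi omega delta2)
    (Delta_equiv : bihom_equivariant alpha beta psi omega Delta) :
  (covariant mu alpha beta psi omega delta1 delta2 Delta
     /\ coassociative psi omega Delta)
  <->
  (exists u : tens A A,
    [/\ forall a, delta1 a - delta2 a =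
          lact mu beta omega (alphaV a) u - ract mu alpha psi u (betaV a),
        forall a, tassoc (tmap delta1 psi (delta1 a))
                  - tmap omega delta1 (delta1 a) =
          mul_23_13 mu alpha beta psi omega u (delta1 (betaV a)),
        tassoc (tmap delta1 psi u) - tmap omega delta1 u =
          mul_23_13 mu alpha beta psi omega u u - mul_12_23 mu alpha beta u u
      & forall a,
          Delta a = tlift (fun u1 u2 =>
                      alpha u1 ⊗ mu (u2 ⊗ psi (betaV a))) u + delta1 a
          /\ Delta a = tlift (fun u1 u2 =>
                      mu (omega (alphaV a) ⊗ u1) ⊗ beta u2) u + delta2 a]).
Proof.
have delta1_1 := bihom_derivation1 A_unit psi1 omega1 delta1P.
have [alpha1 beta1 mul_one one_mul] := A_unit.
have [_ alphaM betaM _] := A_assoc.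
have [[_ delta1B delta1psi _] delta1M] := delta1P.
have [[delta2A _ _ _] delta2M] := delta2P.
have [DeltaA DeltaB Deltapsi Deltaomega] := Delta_equiv.
have invariant (F : {linear A -> A}) :
    intertwines F Delta -> F one = one ->
    tmap F F (Delta one) = Delta one.
  by move=> DeltaF F1; rewrite DeltaF F1.
have u_alpha := invariant _ DeltaA alpha1.
have u_beta := invariant _ DeltaB beta1.
have u_psi := invariant _ Deltapsi psi1.
have u_omega := invariant _ Deltaomega omega1.
split=> [[cov /coassociativeP coassoc]|[u [_ d_d1 d_u DeltaE]]].
- have DeltaE1 a :
      Delta a = ract mu alpha psi (Delta one) (betaV a) + delta1 a.
    rewrite -{1 3}[a]betaVK -one_mul (cov _ _).1 (lact1 A_unit) //.
    by rewrite delta1B one_mul.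
  have DeltaE2 a :
      Delta a = lact mu beta omega (alphaV a) (Delta one) + delta2 a.
    rewrite -{1 3}[a]alphaVK -mul_one (cov _ _).2 (ract1 A_unit) //.
    by rewrite delta2A mul_one.
  have Delta_beta a :
      Delta (beta a) = ract mu alpha psi (Delta one) a + delta1 (beta a).
    by rewrite DeltaE1 betaK.
  (* [Delta one] is itself a value of [Delta], hence in the kernel of the
     defect. *)
  have defect_u := coassoc one.
  exists (Delta one); split=> [a|a||a].
  + apply/eqP; rewrite subr_eq addrAC eq_sym subr_eq [eqbRHS]addrC.
    by rewrite -DeltaE2 DeltaE1.
  + have := coassoc_defect_total psi_beta omega_alpha omega_beta psiM
      Delta_beta DeltaA (fun a b => (cov a b).1) delta1B delta1psi u_omega
      (betaV a).
    by rewrite betaVK coassoc defect_u linear0 add0r => /esym/subr0_eq.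
  + have := coassoc_defect_u psi_beta omega_beta Delta_beta u_beta u_psi.
    rewrite defect_u => /esym/eqP; rewrite addr_eq0 opprB => /eqP.
    exact.
  + by split; [exact: DeltaE1 | exact: DeltaE2].
- have uE : Delta one = u.
    have Delta1 : Delta one = tmap alpha alpha u.
      rewrite (DeltaE one).1 delta1_1 addr0 -{1}beta1 betaK.
      exact: (ract1 A_unit).
    apply: (tmap_cancel alphaK alphaVK); by rewrite u_alpha.
  rewrite uE in u_alpha u_beta u_psi u_omega.
  have Delta_beta a :
      Delta (beta a) = ract mu alpha psi u a + delta1 (beta a).
    by rewrite (DeltaE _).1 betaK.
  have Delta_alpha a :
      Delta (alpha a) = lact mu beta omega a u + delta2 (alpha a).
    by rewrite (DeltaE _).2 alphaK.
  have cov : covariant mu alpha beta psi omega delta1 delta2 Delta.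
    move=> a b; split.
    + rewrite -[a]betaVK -[b]betaVK -betaM !Delta_beta betaM delta1M ractD.
      by rewrite (ract_ract A_assoc) // u_alpha [in RHS]addrAC addrA.
    + rewrite -[a]alphaVK -[b]alphaVK -alphaM !Delta_alpha alphaM delta2M.
      by rewrite lactD (lact_lact A_assoc) // u_beta addrA.
  split=> //; apply/coassociativeP => a; rewrite -[a]betaVK.
  rewrite (coassoc_defect_total psi_beta omega_alpha omega_beta psiM
    Delta_beta DeltaA (fun a b => (cov a b).1) delta1B delta1psi u_omega).
  rewrite (coassoc_defect_u psi_beta omega_beta Delta_beta u_beta u_psi).
  rewrite [coassoc_defect _ _ delta1 u]d_u.
  rewrite [coassoc_defect _ _ delta1 (delta1 _)]d_d1 betaK.
  by rewrite subrr addr0 addrC subrKA subrr linear0.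
Qed.
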